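(* Let $J:\mathbb{R}^n\to[0,\infty)$ be convex, lower semicontinuous and absolutely one-homogeneous, satisfying (PS) and (MINSUB), and let $f\in\mathbb{R}^n$. Then: 1. $p_{GF}(s)\in\partial J(u_{GF}(t))$ for all $t\ge s>0$. 2. $u_{GF}(t)=u_{VM}(t)$ for all $t$, where $u_{VM}(t)$ is the solution of the variational method. The relation of the corresponding subgradients is given, for $t>0$, by $$p_{VM}(t)=\frac1t\int_0^tp_{GF}(s)\,ds\in\partial J(u_*(t)),\qquad *\in\{VM,GF\}.$$
   Context: Absolutely one-homogeneous means $J(su)=|s|J(u)$ for all $s\in\mathbb{R}$, $u\in\mathbb{R}^n$; $\partial J$ is the convex subdifferential; $\langle\cdot,\cdot\rangle$, $\|\cdot\|$ are Euclidean. (PS): there exists a finite set whose convex hull equals $\partial J(0)$. (MINSUB): for all $u\in\mathbb{R}^n$, the element $\hat p=\arg\min\{\|p\|^2: p\in\partial J(u)\}$ satisfies $\langle\hat p,\hat p-q\rangle=0$ for all $q\in\partial J(u)$. Gradient flow: $\partial_tu_{GF}(t)=-p_{GF}(t)$, $p_{GF}(t)\in\partial J(u_{GF}(t))$ for a.e. $t>0$, $u_{GF}(0)=f$. Under (PS) there are finitely many breakpoints $0=t_0<t_1<\dots<t_K=\infty$ such that $p_{GF}$ is constant between them, and $p_{GF}(t)$ denotes its constant value on $(t_i,t_{i+1}]$ (for the last, unbounded interval: on $(t_{K-1},\infty)$). Variational method: $u_{VM}(t)=\arg\min_u\frac12\|u-f\|^2+tJ(u)$ for $t>0$, $u_{VM}(0)=f$;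 $p_{VM}(t)=(f-u_{VM}(t))/t\in\partial J(u_{VM}(t))$. *)

(* Defs.v *)
From HB Require Import structures.
From mathcomp Require Import all_boot all_order all_algebra.
From mathcomp Require Import all_classical all_reals all_analysis.

Set Implicit Arguments.
Unset Strict Implicit.
Unset Printing Implicit Defensive.

Import Order.TTheory GRing.Theory Num.Theory.
Import numFieldNormedType.Exports.

Local Open Scope classical_set_scope.
Local Open Scope ring_scope.

Section defs.
Context {R : realType} {n : nat}.
Implicit Types (J : 'rV[R]_n -> R) (f u v p q : 'rV[R]_n).
Implicit Types (x y : R -> 'rV[R]_n) (t : R).

Definition dot u v : R := \sum_(i < n) u 0 i * v 0 i.

(* The norm [`|u|] of the library on row vectors is the maximum norm. *)
Definition enorm u : R := Num.sqrt (dot u u).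

Definition one_homogeneous J := forall (s : R) u, J (s *: u) = `|s| * J u.

Definition subdiff J u : set 'rV[R]_n :=
  [set p | forall v, J u + dot p (v - u) <= J v].

Definition convex_hull (A : set 'rV[R]_n) : set 'rV[R]_n :=
  smallest (@convex_set R 'rV[R]_n) A.

Definition argmin (A : set 'rV[R]_n) (g : 'rV[R]_n -> R) : set 'rV[R]_n :=
  [set u | A u /\ forall v, A v -> g u <= g v].

Definition PS J :=
  exists2 V : set 'rV[R]_n, finite_set V & convex_hull V = subdiff J 0.

Definition MINSUB J := forall u phat,
  argmin (subdiff J u) (fun p => enorm p ^+ 2) phat ->
  forall q, subdiff J u q -> dot phat (phat - q) = 0.

(* Absolute continuity on every compact interval [`[0, T]]. *)
Definition locally_abs_continuous x :=
  forall T e : R, 0 < T -> 0 < e -> exists2 d : R, 0 < d &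
    forall (m : nat) (a b : 'I_m -> R),
      (forall i, [/\ 0 <= a i, a i <= b i & b i <= T]) ->
      trivIset setT (fun i => `]a i, b i[%classic) ->
      \sum_(i < m) (b i - a i) < d ->
      \sum_(i < m) enorm (x (b i) - x (a i)) < e.

(* Solutions in the usual strong sense; as functions of [R], [x] and [y] are
   unconstrained at negative times, and [y] only matters almost everywhere. *)
Definition gradient_flow J f x y :=
  [/\ locally_abs_continuous x,
      x 0 = f &
      {ae lebesgue_measure, forall t, 0 < t ->
         is_derive t (1 : R) x (- y t) /\ subdiff J (x t) (y t)}].

(* As [tau K = +oo], the last interval is [`]tau K.-1, +oo[]. *)
Definition piecewise_constant y :=
  exists (K : nat) (tau : nat -> \bar R),
    [/\ tau 0%N = 0%E, tau K = +oo%E,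
        (forall i, (i < K)%N -> (tau i < tau i.+1)%E) &
        forall i, (i < K)%N -> exists c : 'rV[R]_n,
          forall t, (tau i < t%:E)%E -> (t%:E <= tau i.+1)%E -> y t = c].

Definition variational_solution J f x :=
  x 0 = f /\
  forall t, 0 < t ->
    argmin setT (fun u => 2^-1 * enorm (u - f) ^+ 2 + t * J u) (x t).

Definition variational_subgradient f x t : 'rV[R]_n := t^-1 *: (f - x t).

Definition vector_integral y t : 'rV[R]_n :=
  \row_(i < n) (\int[lebesgue_measure]_(s in `[0, t]) y s 0 i).

End defs.

(* Main.v *)
Require Import Defs.
From HB Require Import structures.
From mathcomp Require Import all_boot all_order all_algebra.
From mathcomp Require Import all_classical all_reals all_analysis.
From mathcomp Require Import measurable_realfun ring lra.
Import Order.TTheory GRing.Theory Num.Theory.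
Import numFieldNormedType.Exports.
Local Open Scope classical_set_scope.
Local Open Scope ring_scope.

Set Implicit Arguments.
Unset Strict Implicit.
Unset Printing Implicit Defensive.

(** Write D(u) for the subdifferential of J at u. A finite convex, absolutely
    one-homogeneous J is sublinear, hence D(u) consists of those p in D(0) with
    <p, u> = J(u), and J is the support function of D(0)
    ([sublinear_support]). As D(0) is the convex hull of a finite set V, J is
    the maximum of the finitely many functionals <v, .> with v in V
    ([active_vertex]); call v active at u when <v, u> = J(u).

    Let p be the element of least norm in D(u). By the orthogonality condition
    <p, p - q> = 0, all active v lose height at the same rate |p|^2 along
    u - s p. So all of them stay active and J is affine along this ray until an
    inactive vertex catches up ([affine_until_new_vertex]); in the meantime D
    can only grow ([subdiff_grows_on_segment]), and in particular keeps p. The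
    ray is therefore a solution of the flow up to that time. Solutions are
    unique, because D is monotone ([flow_eq_line]). Each breakpoint adds an
    active vertex and no active vertex is ever lost, so there are at most
    #V pieces and D(u(s)) is contained in D(u(t)) whenever s <= t
    ([flow_structure]).

    Once D grows along the flow, the mean velocity (f - u(T)) / T lies in
    D(u(T)), being a mean of elements of that convex set
    ([flow_average_subgradient]). This membership is the optimality condition
    of the variational problem at time T, whose solution is unique
    ([variational_minimizer_unique]); hence the two methods agree, and the
    variational subgradient is the mean of the flow velocity
    ([flow_integral]).

    A solution is an absolutely continuous curve satisfying the inclusion almost
    everywhere. What makes such a curve tractable is that an absolutely
    continuous function whose derivative is almost everywhere nonpositive is
    nonincreasing ([abs_continuous_nonincreasing]). It is applied to the squared
    distance to a line and to functionals that are affine in time and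
    position. *)

(** * The Euclidean inner product *)

Section dot_theory.
Context {R : realType} {n : nat}.
Implicit Types (u v w p : 'rV[R]_n) (a : R).

Lemma dotC u v : dot u v = dot v u.
Proof. by apply: eq_bigr => i _; rewrite mulrC. Qed.

Lemma dotDl u v w : dot (u + v) w = dot u w + dot v w.
Proof. by rewrite -big_split /=; apply: eq_bigr => i _; rewrite mxE mulrDl. Qed.

Lemma dotZl a u v : dot (a *: u) v = a * dot u v.
Proof. by rewrite big_distrr /=; apply: eq_bigr => i _; rewrite mxE mulrA. Qed.

Lemma dotDr u v w : dot u (v + w) = dot u v + dot u w.
Proof. by rewrite !(dotC u) dotDl. Qed.

Lemma dotZr a u v : dot u (a *: v) = a * dot u v.
Proof. by rewrite !(dotC u) dotZl. Qed.

Lemma dotNl u v : dot (- u) v = - dot u v.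
Proof. by rewrite -scaleN1r dotZl mulN1r. Qed.

Lemma dotNr u v : dot u (- v) = - dot u v.
Proof. by rewrite !(dotC u) dotNl. Qed.

Lemma dot0r u : dot u 0 = 0.
Proof. by rewrite -(scale0r 0) dotZr mul0r. Qed.

Definition dotE :=
  (dotDl, dotDr, dotNl, dotNr, dotZl, dotZr, dot0r).

Lemma dot_ge0 u : 0 <= dot u u.
Proof. by apply: sumr_ge0 => i _; rewrite -expr2 sqr_ge0. Qed.

Lemma dot_le0 u : dot u u <= 0 -> u = 0.
Proof.
move=> u0; apply/rowP => i; rewrite mxE; apply/eqP; rewrite -sqrf_eq0.
move: u0; rewrite le_eqVlt ltNge dot_ge0 orbF psumr_eq0.
  by move=> /allP/(_ i); rewrite mem_index_enum expr2; apply.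
by move=> j _; rewrite -expr2 sqr_ge0.
Qed.

Lemma enorm2 u : enorm u ^+ 2 = dot u u.
Proof. by rewrite sqr_sqrtr ?dot_ge0. Qed.

Lemma dot_delta p i : dot p (delta_mx 0 i) = p 0 i.
Proof.
rewrite /dot (bigD1 i) //= big1 ?addr0 => [|j ji].
  by rewrite mxE !eqxx mulr1.
by rewrite mxE (negPf ji) andbF mulr0.
Qed.

End dot_theory.

(** * Supporting functionals of sublinear functions *)
Section sublinear.
Context {R : realType} {n : nat}.
Implicit Types (h : 'rV[R]_n -> R) (u v w p : 'rV[R]_n) (a s : R).

Definition sublinear h :=
  (forall u v, h (u + v) <= h u + h v) /\
  (forall a u, 0 <= a -> h (a *: u) = a * h u).

Lemma sublinear0 h : sublinear h -> h 0 = 0.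
Proof. by case=> _ hZ; rewrite -(scale0r 0) hZ // mul0r. Qed.

Lemma sublinear_sum h m (F : 'I_m -> 'rV[R]_n) :
  sublinear h -> h (\sum_i F i) <= \sum_i h (F i).
Proof.
move=> sh; have [hD _] := sh.
elim/big_ind2: _ => [|x1 x2 y1 y2 h1 h2|//]; first by rewrite sublinear0.
exact: le_trans (hD _ _) (lerD h1 h2).
Qed.

(** A sublinear function that is already odd on the line through [w] cannot be
    lowered there. *)
Lemma sublinear_rigid h h' w :
    sublinear h' -> (forall v, h' v <= h v) -> h (- w) = - h w ->
  h' w = h w /\ h' (- w) = - h' w.
Proof.
move=> sh' h'h hN; have [h'D _] := sh'.
have := h'D w (- w); rewrite subrr sublinear0 // => h'0.
have := h'h w; have := h'h (- w); rewrite hN => ? ?.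
by split; lra.
Qed.

(** The infimum pushes [h] down until it becomes odd on the line through [w];
    this is one step of the extension procedure in the Hahn-Banach theorem. *)
Lemma sublinear_odd_along h w : sublinear h ->
  exists h', [/\ sublinear h', forall v, h' v <= h v,
    h' w = h w & h' (- w) = - h' w].
Proof.
move=> sh; have [hD hZ] := sh.
pose A v := [set h (v + s *: w) - s * h w | s in [set s : R | 0 <= s]].
have lbA v : lbound (A v) (- h (- v)).
  move=> _ [s /= s0 <-]; rewrite lerBrDr -(hZ s w) //.
  have := hD (v + s *: w) (- v); rewrite addrAC subrr add0r.
  by rewrite -/(h (- v)); lra.
have hlbA v : has_lbound (A v) by exists (- h (- v)).
pose h' v := inf (A v).
have h'le v s : 0 <= s -> h' v <= h (v + s *: w) - s * h w.
  by move=> s0; apply: ge_inf => //; exists s.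
have leh' v x : (forall s, 0 <= s -> x <= h (v + s *: w) - s * h w) -> x <= h' v.
  move=> xA; apply: lb_le_inf; first by exists (h (v + 0 *: w) - 0 * h w); exists 0 => /=.
  by move=> _ [s /= s0 <-]; exact: xA.
have h'h v : h' v <= h v.
  by have := h'le v 0 (lexx _); rewrite scale0r addr0 mul0r subr0.
have h'D u v : h' (u + v) <= h' u + h' v.
  rewrite -lerBlDr; apply: (leh' u) => s s0.
  rewrite lerBlDl -lerBlDr; apply: (leh' v) => t t0.
  have st0 : 0 <= s + t by lra.
  have := h'le (u + v) (s + t) st0; rewrite scalerDl addrACA.
  by have := hD (u + s *: w) (v + t *: w); lra.
have h'0 : h' 0 = 0.
  apply/eqP; rewrite eq_le -{1}(sublinear0 sh) h'h /=.
  by apply: leh' => s s0; rewrite add0r hZ // subrr.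
have h'Z1 a v : 0 < a -> h' (a *: v) <= a * h' v.
  move=> a0; rewrite mulrC -ler_pdivrMr //; apply: leh' => s s0.
  have := h'le (a *: v) (a * s) (mulr_ge0 (ltW a0) s0).
  rewrite -scalerA -scalerDr (hZ _ _ (ltW a0)) -mulrA -mulrBr => h'av.
  by rewrite ler_pdivrMr // [leRHS]mulrC.
have h'Z a v : 0 <= a -> h' (a *: v) = a * h' v.
  rewrite le_eqVlt => /predU1P[<-|a0]; first by rewrite scale0r h'0 mul0r.
  apply/eqP; rewrite eq_le h'Z1 //= mulrC -ler_pdivlMr // mulrC.
  by have := h'Z1 a^-1 (a *: v); rewrite scalerA mulVf ?gt_eqF // scale1r invr_gt0; apply.
have h'N : h' (- w) <= - h w.
  by have := h'le (- w) 1 ler01; rewrite scale1r addNr sublinear0 // mul1r sub0r.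
have := h'D w (- w); rewrite subrr h'0 => h'w; have := h'h w => h'w1.
by exists h'; split => //; lra.
Qed.

Lemma sublinear_odd_along_seq h (ws : seq 'rV[R]_n) : sublinear h ->
  exists h', [/\ sublinear h', forall v, h' v <= h v &
    forall w, w \in ws -> h' (- w) = - h' w].
Proof.
move=> sh; elim: ws => [|w ws [h1 [sh1 h1h h1N]]]; first by exists h.
have [h2 [sh2 h2h1 h2w h2N]] := sublinear_odd_along w sh1.
exists h2; split => // [v|v]; first exact: le_trans (h2h1 v) (h1h v).
rewrite inE => /predU1P[-> //|/h1N vN].
by have [] := sublinear_rigid sh2 h2h1 vN.
Qed.

(** The form of the Hahn-Banach theorem needed here: lowering [h] to a function
    that is odd on the line through [u] and then on every coordinate axis
    leaves a linear one. *)
Lemma sublinear_support h u : sublinear h ->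
  exists p, (forall v, dot p v <= h v) /\ dot p u = h u.
Proof.
move=> sh; have [h1 [sh1 h1h h1u h1N]] := sublinear_odd_along u sh.
have [h2 [sh2 h2h1 h2N]] :=
  sublinear_odd_along_seq [seq delta_mx 0 i | i : 'I_n] sh1.
have h2Z a i : h2 (a *: delta_mx 0 i) = a * h2 (delta_mx 0 i).
  have [a0|/ltW a0] := leP 0 a; first exact: sh2.2.
  rewrite -[a]opprK scaleNr -scalerN sh2.2 ?oppr_ge0 // h2N ?mulrN ?mulNr //.
  by apply: map_f; rewrite mem_enum.
pose p : 'rV[R]_n := \row_i h2 (delta_mx 0 i).
have h2p v : h2 v <= dot p v.
  rewrite {1}(row_sum_delta v); apply: le_trans (sublinear_sum _ sh2) _.
  by apply: ler_sum => i _; rewrite h2Z mxE mulrC.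
have pE v : dot p v = h2 v.
  apply/eqP; rewrite eq_le h2p andbT.
  have := sh2.1 v (- v); rewrite subrr sublinear0 //.
  by have := h2p (- v); rewrite dotNr; lra.
exists p; split => [v|]; rewrite pE; first exact: le_trans (h2h1 v) (h1h v).
by have [-> _] := sublinear_rigid sh2 h2h1 h1N.
Qed.

End sublinear.

(** * Polyhedral sublinear functions *)
Lemma sub_in_count_lt (T : eqType) (P Q : pred T) (s : seq T) (x : T) :
    {in s, subpred Q P} -> x \in s -> P x -> ~~ Q x ->
  (count Q s < count P s)%N.
Proof.
move=> QP xs Px nQx; rewrite (permP (perm_to_rem xs) Q) (permP (perm_to_rem xs) P) /=.
rewrite Px (negPf nQx) add0n add1n ltnS.
elim: (rem x s) (mem_rem (s := s) (x := x)) => [//|y r IHr] sr /=.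
apply: leq_add; last by apply: IHr => z zr; apply: sr; rewrite inE zr orbT.
by have /QP := sr y (mem_head _ _); case: (Q y) => // ->.
Qed.

Lemma seq_argmin (R : realType) (T : eqType) (s : seq T) (r : T -> R) :
  s != [::] -> exists2 v, v \in s & forall w, w \in s -> r v <= r w.
Proof.
elim: s => // x s IHs _; have [->|/IHs[v vs vmin]] := eqVneq s [::].
  by exists x; rewrite ?mem_head // => w; rewrite inE => /eqP ->.
have [xv|/ltW vx] := leP (r x) (r v).
  exists x; first exact: mem_head.
  by move=> w; rewrite inE => /predU1P[->//|/vmin]; exact: le_trans.
exists v; first by rewrite inE vs orbT.
by move=> w; rewrite inE => /predU1P[->//|/vmin].
Qed.

Section subdifferential.
Context {R : realType} {n : nat}.
Implicit Types (J : 'rV[R]_n -> R) (u v w p q : 'rV[R]_n) (a s : R).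

Lemma convex_homogeneous_sublinear J :
  @convex_function R 'rV[R]_n setT J -> one_homogeneous J -> sublinear J.
Proof.
move=> Jc Jh; split => [u v|a u a0]; last by rewrite Jh ger0_norm.
have h0 : 0 <= 2^-1 :> R by lra.
have h1 : 2^-1 <= 1 :> R by lra.
have := Jc (Itv01 h0 h1) (2 *: u) (2 *: v) (in_setT _) (in_setT _).
rewrite convRE /conv /= /unstable.onem (_ : 1 - 2^-1 = 2^-1); last by lra.
rewrite !scalerA mulVf ?pnatr_eq0 // !scale1r .
by rewrite !Jh ger0_norm //; lra.
Qed.

(** Testing the subgradient inequality at [0] and at [2 *: u] forces
    [dot p u = J u]. *)
Lemma subdiffP J u p : sublinear J ->
  subdiff J u p <-> (forall v, dot p v <= J v) /\ dot p u = J u.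
Proof.
move=> sJ; split => [pJ|[pJ pu] v]; last by rewrite !dotE pu; have := pJ v; lra.
have := pJ 0; have := pJ (2 *: u); rewrite sublinear0 // sJ.2 // !dotE => h1 h2.
have pu : dot p u = J u by lra.
by split => // v; have := pJ v; rewrite !dotE pu; lra.
Qed.

Lemma continuous_sum (T : topologicalType) m (F : 'I_m -> T -> R) :
  (forall i, continuous (F i)) -> continuous (fun x => \sum_i F i x).
Proof.
move=> cF x; rewrite -fct_sumE; elim/big_ind: _ => [|f g|i _].
- exact: cst_continuous.
- exact: continuousD.
- exact: cF.
Qed.

Lemma dot_continuous q : continuous (fun p : 'rV[R]_n => dot p q).
Proof.
apply: continuous_sum => i p.
by apply: continuousM; [exact: coord_continuous|exact: cst_continuous].
Qed.

Lemma enorm2_continuous : continuous (fun p : 'rV[R]_n => enorm p ^+ 2).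
Proof.
rewrite (_ : (fun p => _) = fun p : 'rV[R]_n => dot p p).
  by apply: continuous_sum => i p; apply: continuousM; exact: coord_continuous.
by apply/funext => p; rewrite enorm2.
Qed.

Lemma subdiff_compact J u : sublinear J -> compact (subdiff J u).
Proof.
move=> sJ; apply: bounded_closed_compact.
  pose M := \sum_i (`|J (delta_mx 0 i)| + `|J (- delta_mx 0 i)|).
  exists M; split; first exact: num_real.
  move=> x Mx p /(subdiffP _ _ sJ)[pJ _] /=.
  have M0 : 0 <= M by apply: sumr_ge0 => i _; exact: addr_ge0.
  rewrite /Num.Def.normr /= mx_normrE; apply: bigmax_le => [|[i j] _ /=].
    by apply: ltW; exact: le_lt_trans Mx.
  rewrite (ord1 i) (le_trans _ (ltW Mx)) // /M (bigD1 j) //=.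
  set S := \sum_(_ | _) _; have S0 : 0 <= S.
    by apply: sumr_ge0 => k _; exact: addr_ge0.
  have := pJ (delta_mx 0 j); have := pJ (- delta_mx 0 j).
  rewrite dotNr dot_delta; have := ler_norm (J (delta_mx 0 j)).
  have := ler_norm (J (- delta_mx 0 j)); have := normr_ge0 (J (delta_mx 0 j)).
  have := normr_ge0 (J (- delta_mx 0 j)); rewrite ler_norml => *.
  by apply/andP; split; lra.
rewrite (_ : subdiff J u = \bigcap_v [set p | dot p (v - u) <= J v - J u]).
  apply: closed_bigI => v _.
  apply: (preimage_closed _ (@closed_le R (J v - J u))) => p _.
  exact: dot_continuous.
apply/seteqP; split => p hp v; first by move=> _ /=; have := hp v; lra.
by have := hp v I; rewrite /=; lra.
Qed.

Lemma subdiff_nonempty J u : sublinear J -> subdiff J u !=set0.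
Proof.
by move=> sJ; have [p hp] := sublinear_support u sJ; exists p; apply/subdiffP.
Qed.

Lemma min_norm_subgradient J u : sublinear J ->
  exists p, argmin (subdiff J u) (fun p => enorm p ^+ 2) p.
Proof.
move=> sJ; have [|p pu pmin] := EVT_min_rV (subdiff_nonempty u sJ) (@subdiff_compact J u sJ)
    (f := fun p => enorm p ^+ 2).
  by apply: continuous_subspaceT; exact: enorm2_continuous.
exists p; split; first by rewrite inE in pu.
by move=> v vu; apply: pmin; rewrite inE.
Qed.

End subdifferential.

Section polyhedral.
Context {R : realType} {n : nat} (J : 'rV[R]_n -> R) (V : seq 'rV[R]_n).
Hypotheses (sJ : sublinear J) (hV : convex_hull [set` V] = subdiff J 0).
Implicit Types (u v w p q : 'rV[R]_n) (a s d : R).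

Lemma vertex_le v u : v \in V -> dot v u <= J u.
Proof.
move=> vV; have /subdiffP -/(_ sJ)[+ _] : subdiff J 0 v; last exact.
by rewrite -hV; apply: sub_gen_smallest.
Qed.

(** If no vertex were active at [u], then [subdiff J 0] would lie in the open
    half-space of all [p] with [dot p u < J u], which contradicts the existence
    of a supporting functional. *)
Lemma active_vertex u : exists2 v, v \in V & dot v u = J u.
Proof.
apply: contrapT => noactive.
have [p [pJ pu]] := sublinear_support u sJ.
have p0 : subdiff J 0 p by apply/subdiffP => //; rewrite dot0r sublinear0.
suff : dot p u < J u by rewrite pu ltxx.
move: p p0 {pJ pu}; rewrite -hV; apply: smallest_sub => [|v /= vV].
  apply/convex_setW => x y /[!inE] xu yu k k0 k1 /=.
  rewrite inE /conv /= /unstable.onem !dotE; nra.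
rewrite lt_neqAle vertex_le // andbT; apply/eqP => vu.
by apply: noactive; exists v.
Qed.

(** Along a min-norm subgradient [p], every active vertex loses height at the
    same rate [dot p p], so [J] is affine until an inactive vertex that falls
    more slowly catches up; the time [d] is the first such meeting time. *)
Lemma affine_until_new_vertex u p :
    subdiff J u p -> (forall q, subdiff J u q -> dot p q = dot p p) ->
  (forall s, 0 <= s -> J (u - s *: p) = J u - s * dot p p) \/
  exists2 d, 0 < d &
    (forall s, 0 <= s <= d -> J (u - s *: p) = J u - s * dot p p) /\
    exists2 v, v \in V & dot v u != J u /\ dot v (u - d *: p) = J (u - d *: p).
Proof.
move=> /subdiffP -/(_ sJ)[pJ pu] pq.
have low s : J u - s * dot p p <= J (u - s *: p).
  by have := pJ (u - s *: p); rewrite !dotE pu.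
have act v : v \in V -> dot v u = J u -> dot v p = dot p p.
  move=> vV vu; rewrite dotC; apply: pq; apply/subdiffP => //; split => // w.
  exact: vertex_le.
pose W := [seq v <- V | (dot v u != J u) && (dot v p < dot p p)].
pose r v := (J u - dot v u) / (dot p p - dot v p).
(* [r v] is the time at which the inactive vertex [v] reaches height [J]. *)
have aff s : 0 <= s -> (forall v, v \in W -> s <= r v) ->
    J (u - s *: p) = J u - s * dot p p.
  move=> s0 sr; apply/eqP; rewrite eq_le low andbT.
  have [v vV <-] := active_vertex (u - s *: p).
  rewrite !dotE; have := vertex_le u vV.
  have [vu _|vNu vu] := eqVneq (dot v u) (J u); first by rewrite vu act.
  have [vp|pv] := ltP (dot v p) (dot p p); last by nra.
  have := sr v; rewrite mem_filter vNu vp vV => /(_ isT).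
  by rewrite /r ler_pdivlMr ?subr_gt0 //; lra.
have [W0|/(seq_argmin r)[v vW vmin]] := eqVneq W [::].
  by left => s s0; apply: aff => // v; rewrite W0.
have : v \in W by []; rewrite mem_filter => /andP[/andP[vNu vp] vV].
right; exists (r v).
  rewrite divr_gt0 // subr_gt0 // lt_neqAle vNu; exact: vertex_le.
split => [s /andP[s0 sr]|].
  by apply: aff => // w wW; exact: le_trans sr (vmin w wW).
exists v => //; split => //; rewrite aff //.
  by rewrite !dotE /r; field; rewrite subr_eq0 gt_eqF.
by rewrite divr_ge0 // subr_ge0 ?(ltW vp) ?vertex_le.
Qed.

(** [J (u - s *: p) - dot q (u - s *: p)] is nonnegative and affine in [s]; it
    vanishes at [a], hence on all of the interval when [0 < a < b], while for
    [a = 0] it is constant by the hypothesis on [p]. *)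
Lemma subdiff_grows_on_segment u p a b :
    (forall q, subdiff J u q -> dot p q = dot p p) ->
    0 <= a -> a <= b ->
    (forall s, 0 <= s <= b -> J (u - s *: p) = J u - s * dot p p) ->
  subdiff J (u - a *: p) `<=` subdiff J (u - b *: p).
Proof.
move=> pq a0 ab aff q /subdiffP -/(_ sJ)[qJ].
have affa : J (u - a *: p) = J u - a * dot p p by apply: aff; rewrite a0.
have affb : J (u - b *: p) = J u - b * dot p p.
  by apply: aff; rewrite (le_trans a0 ab) /=.
rewrite affa !dotE => qa; apply/subdiffP => //; split => //.
rewrite affb !dotE.
have qu := qJ u; have := qJ (u - b *: p); rewrite affb !dotE => qb.
move: a0 ab; rewrite le_eqVlt => /predU1P[a0|a0].
  have pq' : dot p q = dot p p.
    by apply: pq; apply/subdiffP => //; split => //; rewrite -a0 in qa; lra.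
  by rewrite (dotC q p) pq' -a0 in qa * => _; lra.
rewrite le_eqVlt => /predU1P[<- //|ab]; nra.
Qed.

Definition inactive u := count (fun v => dot v u != J u) V.

Lemma inactive_decreases u u' v :
    subdiff J u `<=` subdiff J u' -> v \in V ->
    dot v u != J u -> dot v u' = J u' ->
  (inactive u' < inactive u)%N.
Proof.
move=> uu' vV vu vu'.
apply: (sub_in_count_lt (x := v)) => //=; last by rewrite vu' eqxx.
move=> w wV /=; apply: contra => /eqP wu; apply/eqP.
have /uu'/subdiffP -/(_ sJ)[_ //] : subdiff J u w.
by apply/subdiffP => //; split => // x; exact: vertex_le.
Qed.

End polyhedral.

(** * Absolutely continuous functions with nonpositive derivative *)
Section absolutely_continuous.
Context {R : realType}.
Implicit Types (g h : R -> R) (a b c t : R).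
Let mu := @lebesgue_measure R.

Definition abs_continuous g a b := forall e : R, 0 < e -> exists2 d : R, 0 < d &
  forall (m : nat) (l r : 'I_m -> R),
    (forall i, [/\ a <= l i, l i <= r i & r i <= b]) ->
    trivIset setT (fun i => `]l i, r i[%classic) ->
    \sum_(i < m) (r i - l i) < d ->
    \sum_(i < m) `|g (r i) - g (l i)| < e.

Lemma derive_le0_growth g t (g' e : R) : is_derive t (1 : R) g g' -> g' <= 0 -> 0 < e ->
  exists2 rho, 0 < rho & forall x y, t - rho < x -> x <= t -> t <= y -> y < t + rho ->
    g y - g x <= e * (y - x).
Proof.
move=> [dg <-] g'0 e0.
have /cvgrPdist_lt/(_ _ e0) := dg; rewrite -/('D_1 g t).
rewrite near_withinE => /nbhs_ballP[rho /= rho0 H]; exists rho => // x y xr xt ty yr.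
have slope z : `|z - t| < rho -> z != t -> (g z - g t) / (z - t) < e.
  move=> zr zt; have := H (z - t); rewrite /ball /= sub0r normrN => /(_ zr).
  rewrite subr_eq0 => /(_ zt); rewrite /= scaler1 [z - t + t]subrK.
  by rewrite ltr_distl => /andP[+ _]; rewrite /GRing.scale /= [_^-1 * _]mulrC; lra.
have hy : g y - g t <= e * (y - t).
  move: ty; rewrite le_eqVlt => /predU1P[->|ty]; first by rewrite !subrr mulr0.
  rewrite -ler_pdivrMr ?subr_gt0 //; apply/ltW/slope; last by rewrite gt_eqF.
  by rewrite gtr0_norm ?subr_gt0 // ltrBlDl.
have hx : g t - g x <= e * (t - x).
  move: xt; rewrite le_eqVlt => /predU1P[->|xt]; first by rewrite !subrr mulr0.
  rewrite -ler_pdivrMr ?subr_gt0 // -[leLHS]mulrNN -invrN !opprB.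
  apply/ltW/slope; last by rewrite lt_eqF.
  by rewrite ltr0_norm ?subr_lt0 //; lra.
lra.
Qed.

Lemma sum_disjoint_itv_le (U : set R) m (l r : nat -> R) : measurable U ->
    (forall i, (i < m)%N -> l i <= r i /\ `]l i, r i[%classic `<=` U) ->
    (forall i j, (i < j)%N -> (j < m)%N -> r i <= l j) ->
  trivIset setT (fun i : 'I_m => `]l i, r i[%classic) /\
  ((\sum_(i < m) (r i - l i))%:E <= mu U)%E.
Proof.
move=> mU lrU rl.
have triv : trivIset setT (fun i : 'I_m => `]l i, r i[%classic).
  apply/trivIsetP => i j _ _ ij; apply/seteqP; split => x //=.
  rewrite !in_itv /= => -[/andP[lx xr] /andP[lx' xr']].
  case: (ltngtP i j) => [/rl|/rl|/val_inj/eqP]; last by rewrite (negPf ij).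
    by move=> /(_ (ltn_ord _)); lra.
  by move=> /(_ (ltn_ord _)); lra.
split=> //; rewrite -sumEFin.
rewrite (eq_bigr (fun i : 'I_m => mu `]l i, r i[%classic)); last first.
  move=> i _; rewrite /mu lebesgue_measure_itv /= lte_fin.
  have [] := lrU _ (ltn_ord i); rewrite le_eqVlt => /predU1P[->|->] // _.
  by rewrite ltxx subrr.
have mV : measurable (\big[setU/set0]_(i < m) `]l i, r i[%classic).
  by apply: bigsetU_measurable => i _.
rewrite -[leLHS](@measure_semi_additive_ord _ _ _ mu _ _ _ triv mV) //.
apply: le_measure; rewrite ?inE //.
rewrite -(bigcup_mkord m (fun i => `]l i, r i[%classic)) => x [i /= im].
exact: (lrU i im).2.
Qed.

(** An increase of [g] by more than [e] times the elapsed time can only happen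
    in steps through exceptional points. These lie in an open set [U] of measure
    less than [d], so the steps are disjoint intervals of total length less than
    [d] and contribute less than [e] by absolute continuity. A supremum argument
    on the times that can be reached by finitely many steps shows that [b] is
    one of them. *)
Lemma abs_continuous_nonincreasing g a b : a <= b -> abs_continuous g a b ->
    {ae mu, forall t, a < t < b -> exists2 g', is_derive t (1 : R) g g' & g' <= 0} ->
  g b <= g a.
Proof.
move=> ab ACg [N [mN N0 Nsub]].
suff gab e : 0 < e -> g b - g a <= e * (b - a) + e.
  apply/ler_addgt0Pr => e e0; have b0 : 0 < b - a + 1 by lra.
  have := gab (e / (b - a + 1)) (divr_gt0 e0 b0).
  rewrite -[X in _ <= _ + X]mulr1 -mulrDr mulfVK ?gt_eqF //; lra.
move=> e0; have [d d0 gd] := ACg _ e0.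
(* The endpoints count as exceptional, since the derivative of [g] is
   unknown there. *)
pose N' := N `|` [set a; b].
have mN' : measurable N' by apply: measurableU => //; apply: measurableU.
have N'0 : mu N' = 0%E.
  apply: measure_negligible => //; apply: negligibleU; first by exists N; split.
  apply/negligibleP; first exact: measurableU.
  by apply: countable_lebesgue_measure0; exact: finite_set_countable.
have [|U [oU N'U]] := lebesgue_regularity_outer mN' _ d0.
  by rewrite [X in (X < _)%E]N'0.
have mU : measurable U by exact: open_measurable.
move=> UN'd; have Ud : (mu U < d%:E)%E.
  have -> : mu U = mu (U `\` N'); last exact: UN'd.
  rewrite [LHS](measureDI mu mU mN') [X in (_ + X)%E](_ : _ = 0%E) ?adde0 //.
  by apply: (@subset_measure0 _ _ _ mu _ N') => //; exact: measurableI.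
(* The intervals [(l i, r i)], in increasing order, are the steps through [U]. *)
pose inside m (l r : nat -> R) c :=
  (forall i, (i < m)%N -> [/\ a <= l i, l i <= r i, r i <= c & `]l i, r i[%classic `<=` U])
  /\ (forall i j, (i < j)%N -> (j < m)%N -> r i <= l j).
pose good c := a <= c <= b /\ exists m l r, inside m l r c /\
  g c - g a <= e * (c - a) + \sum_(i < m) `|g (r i) - g (l i)|.
have good_a : good a.
  split; first by rewrite lexx.
  exists 0%N, (fun=> a), (fun=> a); split; first by split.
  by rewrite big_ord0 !subrr mulr0 addr0.
have extend c c' : good c -> c <= c' -> c' <= b ->
    g c' - g c <= e * (c' - c) \/ `]c, c'[%classic `<=` U -> good c'.
  move=> [/andP[ac cb] [m [l [r [[lr rl] gc]]]]] cc' c'b H.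
  split; first by rewrite (le_trans ac cc').
  case: H => [gcc'|ccU].
    exists m, l, r; split; last by lra.
    by split => // i /lr[? ? ? ?]; split => //; lra.
  pose l' i := if i == m then c else l i; pose r' i := if i == m then c' else r i.
  have l'E i : (i < m)%N -> l' i = l i by move=> im; rewrite /l' ltn_eqF.
  have r'E i : (i < m)%N -> r' i = r i by move=> im; rewrite /r' ltn_eqF.
  exists m.+1, l', r'; split; first split.
  - move=> i; rewrite ltnS leq_eqVlt => /predU1P[->|im].
      by rewrite /l' /r' eqxx.
    by rewrite l'E // r'E //; have [? ? ? ?] := lr _ im; split => //; lra.
  - move=> i j ij; rewrite ltnS leq_eqVlt => /predU1P[jm|jm].
      rewrite r'E -?jm // {1}/l' jm eqxx.
      by rewrite jm in ij; have [] := lr _ ij.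
    by rewrite r'E ?(ltn_trans ij) // l'E //; exact: rl.
  rewrite big_ord_recr /= {2}/r' {2}/l' eqxx.
  under eq_bigr => i _ do rewrite r'E ?l'E //.
  have := ler_norm (g c' - g c); have : 0 <= e * (c' - c).
    by rewrite mulr_ge0 // ?subr_ge0 //; exact: ltW.
 
  by move: gc; set X := \sum_(_ < _) _; lra.
have good_ub : ubound [set c | good c] b by move=> c [/andP[]].
have good_sup : has_sup [set c | good c].
  by split; [exists a; exact: good_a|exists b; exact: good_ub].
set s := sup [set c | good c].
have as_ : a <= s by exact: (sup_upper_bound good_sup).
have sb : s <= b by apply: ge_sup => //; exact: good_sup.1.
have [rho rho0 near_s] : exists2 rho, 0 < rho & forall x y,
    s - rho < x -> x <= s -> s <= y -> y < s + rho ->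
    g y - g x <= e * (y - x) \/ `]x, y[%classic `<=` U.
  have [sN'|sN'] := pselect (N' s).
    have /nbhs_ballP[rho /= rho0 rhoU] := open_nbhs_nbhs (conj oU (N'U _ sN')).
    exists rho => // x y ? ? ? ?; right => z /=; rewrite in_itv /= => /andP[? ?].
    by apply: rhoU; rewrite /ball /= ltr_distl; apply/andP; split; lra.
  have [g' dg g'0] : exists2 g', is_derive s (1 : R) g g' & g' <= 0.
    have asb : a < s < b.
      rewrite !lt_neqAle as_ sb !andbT; apply/andP; split; apply/eqP => sE.
        by apply: sN'; right; left.
      by apply: sN'; right; right.
    by apply: contrapT => nd; apply: sN'; left; apply: Nsub => /= /(_ asb).
  have [rho rho0 H] := derive_le0_growth dg g'0 e0.
  by exists rho => // x y *; left; exact: H.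
have [x gx sx] := sup_adherent rho0 good_sup.
have xs : x <= s by exact: (sup_upper_bound good_sup).
pose y := Num.min (s + rho / 2) b.
have sy : s <= y by rewrite le_min sb andbT; lra.
have yrho : y < s + rho by rewrite (@le_lt_trans _ _ (s + rho / 2)) ?ge_min ?lexx //; lra.
have yb : y <= b by rewrite ge_min lexx orbT.
have gy : good y by apply: (extend x) => //; [exact: le_trans sy|exact: near_s].
have ys : y <= s by exact: (sup_upper_bound good_sup).
have eqyb : y = b.
  by move: ys; rewrite /y /Num.min; case: ifP => // _; lra.
move: gy; rewrite eqyb => -[_ [m [l [r [[lr rl] gb]]]]].
have [|//|triv lrd] := @sum_disjoint_itv_le U m l r mU.
  by move=> i /lr[].
have : \sum_(i < m) `|g (r i) - g (l i)| < e.
  apply: gd => //; first by move=> i; have [] := lr _ (ltn_ord i).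
  by rewrite -lte_fin; exact: le_lt_trans Ud.
lra.
Qed.

End absolutely_continuous.

(** * Closure properties of absolute continuity *)
Section absolutely_continuous_theory.
Context {R : realType}.
Implicit Types (g h : R -> R) (a b c t : R).

(** The single tool behind stability under scaling and squaring: a function
    whose increments are controlled by those of [h] inherits its modulus. *)
Lemma abs_continuous_dominated g h C a b :
    (forall s t, a <= s -> s <= t -> t <= b -> `|g t - g s| <= C * `|h t - h s|) ->
  abs_continuous h a b -> abs_continuous g a b.
Proof.
move=> gh ACh e e0; pose D := Num.max C 1.
have D0 : 0 < D by rewrite lt_max ltr01 orbT.
have [d d0 hd] := ACh _ (divr_gt0 e0 D0); exists d => // m l r lr tlr lrd.
apply: le_lt_trans (_ : D * \sum_(i < m) `|h (r i) - h (l i)| < _).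
  rewrite mulr_sumr; apply: ler_sum => i _; have [al lir rb] := lr i.
  by apply: le_trans (gh _ _ al lir rb) _; rewrite ler_wpM2r // le_max lexx.
by rewrite mulrC -ltr_pdivlMr //; exact: hd.
Qed.

Lemma abs_continuous_id a b : abs_continuous id a b.
Proof.
move=> e e0; exists e => // m l r lr _; apply: le_lt_trans.
apply: ler_sum => i _; have [_ lir _] := lr i.
by rewrite ger0_norm // subr_ge0.
Qed.

Lemma abs_continuous_cst c a b : abs_continuous (fun=> c) a b.
Proof.
apply: (abs_continuous_dominated (h := id) (C := 0)); last exact: abs_continuous_id.
by move=> s t _ _ _; rewrite subrr normr0 mul0r.
Qed.

Lemma abs_continuousZ c g a b :
  abs_continuous g a b -> abs_continuous (fun t => c * g t) a b.
Proof.
apply: (abs_continuous_dominated (C := `|c|)) => s t _ _ _.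
by rewrite -mulrBr normrM.
Qed.

Lemma abs_continuousD g h a b : abs_continuous g a b -> abs_continuous h a b ->
  abs_continuous (fun t => g t + h t) a b.
Proof.
move=> ACg ACh e e0; have e20 : 0 < e / 2 by rewrite divr_gt0.
have [d1 d10 gd] := ACg _ e20; have [d2 d20 hd] := ACh _ e20.
exists (Num.min d1 d2); first by rewrite lt_min d10.
move=> m l r lr tlr; rewrite lt_min => /andP[ld1 ld2].
rewrite [ltRHS](splitr e).
apply: le_lt_trans (ltrD (gd _ _ _ lr tlr ld1) (hd _ _ _ lr tlr ld2)).
rewrite -big_split /=; apply: ler_sum => i _.
by rewrite opprD addrACA; exact: ler_normD.
Qed.

Lemma abs_continuousB g h a b : abs_continuous g a b -> abs_continuous h a b ->
  abs_continuous (fun t => g t - h t) a b.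
Proof.
move=> ACg /(@abs_continuousZ (-1)) ACh.
by have := abs_continuousD ACg ACh; under eq_fun do rewrite mulN1r.
Qed.

Lemma abs_continuous_sum n (g : 'I_n -> R -> R) a b :
    (forall i, abs_continuous (g i) a b) ->
  abs_continuous (fun t => \sum_(i < n) g i t) a b.
Proof.
move=> ACg; rewrite -fct_sumE; elim/big_ind: _ => [|h k|i _].
- exact: (@abs_continuous_cst 0 a b).
- exact: abs_continuousD.
- exact: ACg.
Qed.

(** Absolute continuity with [e := 1] bounds the variation on every interval
    shorter than [d], and finitely many of these cover the segment. *)
Lemma abs_continuous_bounded g a b : abs_continuous g a b ->
  exists M, forall t, a <= t -> t <= b -> `|g t| <= M.
Proof.
move=> ACg; have [d d0 gd] := ACg _ ltr01.
have unif s t : a <= s -> s <= t -> t <= b -> t - s < d -> `|g t - g s| < 1.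
  move=> as_ st tb std.
  have := gd 1%N (fun=> s) (fun=> t) (fun=> And3 as_ st tb).
  rewrite !big_ord1; apply => //.
  by apply/trivIsetP => i j _ _; rewrite !ord1.
have step k t : a <= t -> t <= b -> t - a <= k%:R * (d / 2) ->
    `|g t - g a| <= k%:R.
  elim: k t => [|k IHk] t at_ tb.
    rewrite mul0r subr_le0 => ta.
    by rewrite (le_anti (introT andP (conj ta at_))) subrr normr0.
  rewrite -natr1 mulrDl mul1r => tk.
  pose s := Num.max a (t - d / 2).
  have sa : a <= s by rewrite le_max lexx.
  have st : s <= t by rewrite ge_max at_ /=; lra.
  have sd : t - d / 2 <= s by rewrite le_max lexx orbT.
  have sk : s - a <= k%:R * (d / 2).
    rewrite lerBlDr ge_max; apply/andP; split; last by lra.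
    by rewrite lerDr mulr_ge0 // divr_ge0 // ltW.
  have h2 := IHk s sa (le_trans st tb) sk.
  have /ltW h1 : `|g t - g s| < 1 by apply: unif => //; lra.
  have -> : g t - g a = (g s - g a) + (g t - g s) by ring.
  exact: le_trans (ler_normD _ _) (lerD h2 h1).
pose k := Num.bound ((b - a) / (d / 2)).
exists (`|g a| + k%:R) => t at_ tb.
have /(step k t at_ tb) tk : t - a <= k%:R * (d / 2).
  rewrite -ler_pdivrMr ?divr_gt0 //.
  apply: le_trans (_ : (b - a) / (d / 2) <= _).
    by rewrite ler_pM2r ?invr_gt0 ?divr_gt0 // lerB.
  apply/ltW/archi_boundP; rewrite divr_ge0 ?divr_ge0 ?(ltW d0) // subr_ge0.
  exact: le_trans at_ tb.
have -> : g t = g a + (g t - g a) by ring.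
by rewrite (le_trans (ler_normD _ _)) // lerD.
Qed.

Lemma abs_continuous_sqr g a b : abs_continuous g a b ->
  abs_continuous (fun t => g t * g t) a b.
Proof.
move=> ACg; have [M gM] := abs_continuous_bounded ACg.
apply: (abs_continuous_dominated (C := 2 * M)) (ACg) => s t as_ st tb.
rewrite (_ : g t * g t - g s * g s = (g t + g s) * (g t - g s)); last by ring.
rewrite normrM ler_wpM2r // (le_trans (ler_normD _ _)) // mulr2n mulrDl mul1r.
by apply: lerD; apply: gM => //; [exact: le_trans st|exact: le_trans tb].
Qed.

Lemma ae_itv_exists (P : R -> Prop) a b : a < b ->
  {ae lebesgue_measure, forall t : R, P t} -> exists2 t, a < t < b & P t.
Proof.
move=> ab aeP; apply: contrapT => noP.
have neg : lebesgue_measure.-negligible `]a, b[%classic.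
  by apply: negligibleS aeP => t /=; rewrite in_itv /= => tab Pt; apply: noP; exists t.
have : lebesgue_measure `]a, b[%classic = 0%E :> \bar R by apply: measure_negligible.
rewrite lebesgue_measure_itv /= lte_fin ab => /eqP.
by rewrite eqe subr_eq0 gt_eqF.
Qed.

End absolutely_continuous_theory.

(** * Derivatives of curves *)
Section curves.
Context {R : realType} {n : nat}.
Implicit Types (x y z : R -> 'rV[R]_n) (u v w p : 'rV[R]_n) (a b t : R).

(** Reduces derivatives of curves to the calculus of real functions. *)
Lemma is_derive_rowP x t v : is_derive t (1 : R) x v <->
  forall i, is_derive t (1 : R) (fun s => x s 0 i) (v 0 i).
Proof.
split=> [[dx xv] i|dx].
  have dxi := (derivable_mxP x t 1).1 dx 0 i.
  by apply: DeriveDef => //; rewrite -xv derive_mx // mxE.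
have dxd : derivable x t 1.
  by apply/derivable_mxP => i j; rewrite (ord1 i); have [] := dx j.
apply: DeriveDef => //; rewrite derive_mx //; apply/rowP => i; rewrite mxE.
by have [] := dx i.
Qed.

Lemma is_derive_dot x t v w : is_derive t (1 : R) x v ->
  is_derive t (1 : R) (fun s => dot (x s) w) (dot v w).
Proof.
move=> /is_derive_rowP dx.
rewrite (_ : (fun s => _) = \sum_(i < n) (fun s => w 0 i *: x s 0 i)).
  apply: is_derive_eq; rewrite /dot.
  by apply: eq_bigr => i _; rewrite mulrC.
by rewrite fct_sumE; apply/funext => s; apply: eq_bigr => i _; rewrite mulrC.
Qed.

Lemma is_derive_dot2 x t v : is_derive t (1 : R) x v ->
  is_derive t (1 : R) (fun s => dot (x s) (x s)) (2 * dot v (x t)).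
Proof.
move=> /is_derive_rowP dx.
rewrite (_ : (fun s => _) = \sum_(i < n) ((fun s => x s 0 i) * (fun s => x s 0 i))).
  apply: is_derive_eq; rewrite /dot mulr_sumr.
  by apply: eq_bigr => i _; rewrite /GRing.scale /=; ring.
by rewrite fct_sumE; apply/funext => s; apply: eq_bigr.
Qed.

Definition line u t0 p t := u - (t - t0) *: p.

Lemma is_derive_line u t0 p t : is_derive t (1 : R) (line u t0 p) (- p).
Proof.
apply/is_derive_rowP => i.
rewrite (_ : (fun s => _) = cst (u 0 i) - p 0 i *: (id - cst t0)).
  by apply: is_derive_eq; rewrite mxE subr0 sub0r /GRing.scale /= mulr1.
by apply/funext => s; rewrite /line !mxE [LHS]/= mulrC.
Qed.

Lemma locally_abs_continuous_coord x a b i : locally_abs_continuous x ->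
  0 <= a -> a <= b -> abs_continuous (fun t => x t 0 i) a b.
Proof.
move=> ACx a0 ab e e0; have [|d d0 xd] := ACx (b + 1) e _ e0; first by lra.
exists d => // m l r lr tlr lrd; apply: le_lt_trans (xd _ _ _ _ tlr lrd).
  apply: ler_sum => j _; rewrite /enorm /dot -sqrtr_sqr ler_wsqrtr //.
  rewrite (bigD1 i) //= !mxE -expr2 lerDl; apply: sumr_ge0 => k _.
  by rewrite -expr2 sqr_ge0.
by move=> j; have [? ? ?] := lr j; split => //; lra.
Qed.

Lemma abs_continuous_dot x a b w : locally_abs_continuous x ->
  0 <= a -> a <= b -> abs_continuous (fun t => dot (x t) w) a b.
Proof.
move=> ACx a0 ab; apply: abs_continuous_sum => i.
under eq_fun do rewrite mulrC.
exact: (abs_continuousZ (w 0 i) (locally_abs_continuous_coord i ACx a0 ab)).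
Qed.

Lemma abs_continuous_dist2_line x a b u p : locally_abs_continuous x ->
    0 <= a -> a <= b ->
  abs_continuous (fun t => dot (x t - line u a p t) (x t - line u a p t)) a b.
Proof.
move=> ACx a0 ab; apply: abs_continuous_sum => i.
apply: (abs_continuous_sqr (g := fun t => (x t - line u a p t) 0 i)).
rewrite (_ : (fun t => _) =
  fun t => x t 0 i - (u 0 i - (p 0 i * (t - a)))); last first.
  by apply/funext => t; rewrite /line !mxE mulrC.
apply: (abs_continuousB (locally_abs_continuous_coord i ACx a0 ab)).
apply: (abs_continuousB (@abs_continuous_cst _ (u 0 i) a b)).
apply: (abs_continuousZ (p 0 i)); apply: abs_continuousB.
  exact: abs_continuous_id.
exact: abs_continuous_cst.
Qed.

End curves.

(** * The gradient flow of a polyhedral functional *)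
Section flow.
Context {R : realType} {n : nat} (J : 'rV[R]_n -> R) (V : seq 'rV[R]_n).
Hypotheses (sJ : sublinear J) (hV : convex_hull [set` V] = subdiff J 0).
Hypothesis J_MINSUB : MINSUB J.
Variables (f : 'rV[R]_n) (x y : R -> 'rV[R]_n).
Hypothesis GF : gradient_flow J f x y.
Implicit Types (u v w p q : 'rV[R]_n) (a b d s t : R).

(** The form in which the almost everywhere inclusion is used: only times at
    which it holds have to be inspected. *)
Lemma flow_nonincreasing (g : R -> R) a b : 0 <= a -> a <= b -> abs_continuous g a b ->
    (forall t, a < t < b -> is_derive t (1 : R) x (- y t) -> subdiff J (x t) (y t) ->
      exists2 g', is_derive t (1 : R) g g' & g' <= 0) ->
  g b <= g a.
Proof.
move=> a0 ab ACg dg; apply: abs_continuous_nonincreasing => //.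
have [_ _ aeGF] := GF; apply: negligibleS aeGF => t /=; apply: contra_not => xt tab.
have [|dx px] := xt; first by case/andP: tab => at_ _; exact: le_lt_trans at_.
exact: dg tab dx px.
Qed.

(** Its derivative along the flow is [k * (a - dot (y t) w)], so it turns a bound
    on [dot (y t) w] into one on the displacement; the sign [k] chooses the
    direction of the inequality. *)
Definition flow_functional w a k t := k * (t * a + dot (x t) w).

Lemma abs_continuous_flow_functional w a k s t : 0 <= s -> s <= t ->
  abs_continuous (flow_functional w a k) s t.
Proof.
move=> s0 st; have [ACx _ _] := GF.
apply: abs_continuousZ; apply: abs_continuousD; last exact: abs_continuous_dot.
under eq_fun do rewrite mulrC.
exact: (abs_continuousZ a (@abs_continuous_id _ s t)).
Qed.

Lemma is_derive_flow_functional w a k t v : is_derive t (1 : R) x (- v) ->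
  is_derive t (1 : R) (flow_functional w a k) (k * (a - dot v w)).
Proof.
move=> /(is_derive_dot w) dx.
rewrite (_ : flow_functional w a k = k *: (a *: id + (fun s => dot (x s) w))).
  by apply: is_derive_eq; rewrite dotNl /GRing.scale /= mulr1.
by apply/funext => s; rewrite /flow_functional /= [s * _]mulrC.
Qed.

(** Two solutions of the flow approach each other, since the subdifferential is
    a monotone operator; here the second solution is a straight line. *)
Lemma flow_eq_line a b p : 0 <= a -> a <= b ->
    (forall t, a <= t <= b -> subdiff J (line (x a) a p t) p) ->
  forall t, a <= t <= b -> x t = line (x a) a p t.
Proof.
move=> a0 ab hp t /andP[at_ tb]; have [ACx _ _] := GF.
apply/eqP; rewrite -subr_eq0; apply/eqP; apply: dot_le0.
pose g s := dot (x s - line (x a) a p s) (x s - line (x a) a p s).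
have ga : g a = 0 by rewrite /g /line subrr scale0r subr0 subrr dot0r.
rewrite -[leLHS]/(g t) -ga; apply: flow_nonincreasing => //.
  exact: abs_continuous_dist2_line.
move=> s /andP[as_ st] dx vx.
have asb : a <= s <= b by rewrite (ltW as_) (le_trans (ltW st)).
exists (2 * dot (- y s - - p) (x s - line (x a) a p s)).
  by apply: is_derive_dot2; apply: is_deriveB dx (is_derive_line _ _ _ _).
have := vx (line (x a) a p s); have := hp s asb (x s).
by rewrite !dotE; lra.
Qed.

(** For [t0 = 0] this is [piecewise_constant]; a variable starting time is what
    the induction on the pieces needs. *)
Definition piecewise_constant_from t0 (c : R -> 'rV[R]_n) :=
  exists (K : nat) (tau : nat -> \bar R),
    [/\ tau 0%N = t0%:E, tau K = +oo%E,
        (forall i, (i < K)%N -> (tau i < tau i.+1)%E) &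
        forall i, (i < K)%N -> exists p : 'rV[R]_n,
          forall t, (tau i < t%:E)%E -> (t%:E <= tau i.+1)%E -> c t = p].

Lemma piecewise_constant_from_cst t0 p : piecewise_constant_from t0 (fun=> p).
Proof.
exists 1%N, (fun i => if i is 0%N then t0%:E else +oo%E); split => //.
  by case=> // _; rewrite ltry.
by move=> i _; exists p.
Qed.

Lemma piecewise_constant_from_ge t0 K (tau : nat -> \bar R) i :
    tau 0%N = t0%:E -> (forall i, (i < K)%N -> (tau i < tau i.+1)%E) ->
  (i <= K)%N -> (t0%:E <= tau i)%E.
Proof.
move=> tau0 tauS; elim: i => [|i IHi] iK; first by rewrite tau0.
exact: le_trans (IHi (ltnW iK)) (ltW (tauS _ iK)).
Qed.

Lemma piecewise_constant_from_cons t0 t1 p c : t0 < t1 ->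
    piecewise_constant_from t1 c ->
  piecewise_constant_from t0 (fun t => if t <= t1 then p else c t).
Proof.
move=> t01 [K [tau [tau0 tauK tauS tauc]]].
exists K.+1, (fun i => if i is i'.+1 then tau i' else t0%:E); split => //.
  by move=> [_|i iK]; [rewrite tau0 lte_fin|exact: tauS].
move=> [_|i iK]; first by exists p => t _; rewrite tau0 lee_fin => ->.
have [q cq] := tauc i iK; exists q => t it ti.
have := piecewise_constant_from_ge tau0 tauS (ltnW iK : (i <= K)%N).
by move=> /le_lt_trans/(_ it); rewrite lte_fin ltNge => /negbTE ->; exact: cq.
Qed.

Lemma is_derive_near_line a b u t0 p t : a < t < b ->
    (forall s, a <= s <= b -> x s = line u t0 p s) ->
  is_derive t (1 : R) x (- p).
Proof.
move=> tab xl; apply: near_eq_is_derive (is_derive_line u t0 p t).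
have : t \in `]a, b[ by rewrite in_itv.
move=> /near_in_itvoo; apply: filterS => s.
by rewrite in_itv /= => /andP[? ?]; rewrite xl //; apply/andP; split; exact: ltW.
Qed.

(** The ray along the negative min-norm subgradient at [x t0] solves the flow as
    long as [J] is affine on it, so [x] follows the ray by uniqueness: either
    forever, or up to a time [b] at which a new vertex has become active. *)
Lemma flow_first_piece t0 : 0 <= t0 -> exists p : 'rV[R]_n,
  let piece b := [/\ forall t, t0 <= t <= b -> x t = line (x t0) t0 p t,
    forall t, t0 <= t <= b -> subdiff J (x t) p &
    forall s t, t0 <= s -> s <= t -> t <= b -> subdiff J (x s) `<=` subdiff J (x t)] in
  (forall b, t0 < b -> piece b) \/
  exists2 b, t0 < b & piece b /\ (inactive J V (x b) < inactive J V (x t0))%N.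
Proof.
move=> t00; have [p pmin] := min_norm_subgradient (x t0) sJ.
have px := pmin.1.
have pq q : subdiff J (x t0) q -> dot p q = dot p p.
  by move=> /(J_MINSUB pmin); rewrite !dotE; lra.
exists p => piece.
have lineE t : line (x t0) t0 p t = x t0 - (t - t0) *: p by [].
have mkpiece b : t0 < b -> (forall s, 0 <= s <= b - t0 ->
    J (x t0 - s *: p) = J (x t0) - s * dot p p) -> piece b.
  move=> t0b aff.
  have plin t : t0 <= t <= b -> subdiff J (line (x t0) t0 p t) p.
    move=> /andP[t0t tb]; rewrite lineE.
    apply: (subdiff_grows_on_segment sJ pq (lexx 0)) => [|s /andP[s0 st]|].
    - by rewrite subr_ge0.
    - by apply: aff; rewrite s0 (le_trans st) // lerB.
    - by rewrite scale0r subr0.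
  have xlin := flow_eq_line t00 (ltW t0b) plin.
  split => // [t tb|s t t0s st tb]; first by rewrite (xlin t) //; exact: plin.
  have t0t := le_trans t0s st.
  rewrite (xlin s) ?t0s ?(le_trans st tb) // (xlin t) ?t0t // !lineE.
  apply: (subdiff_grows_on_segment sJ pq) => [||r /andP[r0 rt]].
  - by rewrite subr_ge0.
  - by rewrite lerB.
  - by apply: aff; rewrite r0 (le_trans rt) // lerB.
have [aff|[d d0 [aff [v vV [vu vd]]]]] := affine_until_new_vertex sJ hV px pq.
  by left => b t0b; apply: mkpiece => // s /andP[s0 _]; exact: aff.
right; exists (t0 + d); first by rewrite ltrDl.
have pd : piece (t0 + d).
  apply: mkpiece; first by rewrite ltrDl.
  by move=> s; rewrite [t0 + d]addrC addrK; exact: aff.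
split => //; have [xl _ xmono] := pd.
have t0d : t0 <= t0 + d by rewrite lerDl ltW.
apply: (inactive_decreases sJ hV _ vV vu); first exact: xmono.
by rewrite xl ?t0d ?lexx // lineE [t0 + d]addrC addrK.
Qed.

(** Each breakpoint activates a vertex for good, so the number of inactive
    vertices bounds the number of pieces. *)
Lemma flow_structure t0 : 0 <= t0 -> exists (c : R -> 'rV[R]_n) (E : set R),
  [/\ finite_set E, piecewise_constant_from t0 c,
    forall s t, t0 <= s -> s <= t -> subdiff J (x s) `<=` subdiff J (x t) &
    forall t, t0 < t -> ~ E t ->
      is_derive t (1 : R) x (- c t) /\ subdiff J (x t) (c t)].
Proof.
have [k] := ubnP (inactive J V (x t0)); elim: k t0 => // k IHk t0.
rewrite ltnS => Hk t00; have [p [piece|[b t0b [[xl px xmono] Hb]]]] := flow_first_piece t00.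
  exists (fun=> p), set0; split => //.
  - exact: piecewise_constant_from_cst.
  - move=> s t t0s st; have t1 : t0 < t + 1 by lra.
    by have [_ _ mono] := piece _ t1; apply: mono => //; lra.
  - move=> t t0t _; have t1 : t0 < t + 1 by lra.
    have [xl px _] := piece _ t1; split; last by apply: px; apply/andP; split; lra.
    by apply: is_derive_near_line xl; apply/andP; split; lra.
have b0 : 0 <= b by lra.
have [c [E [finE pcc mono dc]]] := IHk b (leq_trans Hb Hk) b0.
exists (fun t => if t <= b then p else c t), (b |` E); split.
- by rewrite finite_setU; split.
- exact: piecewise_constant_from_cons.
- move=> s t t0s st; have [tb|/ltW bt] := leP t b; first exact: xmono.
  have [sb|/ltW bs] := leP s b; last exact: mono.
  by apply: subset_trans (xmono s b _ _ _) (mono b t _ _).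
- move=> t t0t tE; case: leP => [tb|bt]; last first.
    by apply: dc => //; apply: contra_not tE; right.
  have {}tb : t < b.
    by rewrite lt_neqAle tb andbT; apply/eqP => tb'; apply: tE; left.
  split; last by apply: px; rewrite !ltW.
  by apply: is_derive_near_line xl; rewrite t0t.
Qed.

(** Both halves of the membership come from integrating the pointwise relations
    for the velocity: [dot (y t) w <= J w] for every [w], and
    [dot (y t) (x T) = J (x T)], because [y t] stays a subgradient up to [T]. *)
Lemma flow_average_subgradient T : 0 < T -> subdiff J (x T) (T^-1 *: (f - x T)).
Proof.
move=> T0; have [ACx x0 _] := GF.
have [c [E [_ _ mono _]]] := flow_structure (lexx 0).
have le_J w : dot (f - x T) w <= T * J w.
  have : flow_functional w (J w) (-1) T <= flow_functional w (J w) (-1) 0.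
    apply: (flow_nonincreasing (lexx 0) (ltW T0)).
      exact: abs_continuous_flow_functional (ltW T0).
    move=> t _ /is_derive_flow_functional dx /subdiffP -/(_ sJ)[vJ _].
    by eexists; first exact: dx; have := vJ w; lra.
  by rewrite /flow_functional x0 !dotE; lra.
have ge_J : T * J (x T) <= dot (f - x T) (x T).
  have : flow_functional (x T) (J (x T)) 1 T <= flow_functional (x T) (J (x T)) 1 0.
    apply: (flow_nonincreasing (lexx 0) (ltW T0)).
      exact: abs_continuous_flow_functional (ltW T0).
    move=> t /andP[t0 tT] /is_derive_flow_functional dx vx.
    eexists; first exact: dx.
    have /subdiffP -/(_ sJ)[_ ->] := mono t T (ltW t0) (ltW tT) _ vx.
    by rewrite subrr mulr0.
  by rewrite /flow_functional x0 !dotE; lra.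
apply/subdiffP => //; split => [w|].
  by rewrite dotZl mulrC ler_pdivrMr // mulrC; exact: le_J.
have TJ : dot (f - x T) (x T) = T * J (x T) by apply/eqP; rewrite eq_le le_J ge_J.
by rewrite dotZl TJ mulKf ?gt_eqF.
Qed.

End flow.

(** * Comparison with the variational method *)
Section variational.
Context {R : realType} {n : nat}.
Implicit Types (J : 'rV[R]_n -> R) (f u v : 'rV[R]_n) (t : R).

(** The optimality condition makes the objective grow at least by half the
    squared distance to [u], so no other minimiser exists. *)
Lemma variational_minimizer_unique J f u v t : 0 < t ->
    subdiff J u (t^-1 *: (f - u)) ->
    argmin setT (fun w => 2^-1 * enorm (w - f) ^+ 2 + t * J w) v ->
  v = u.
Proof.
move=> t0 /(_ v) hu [_ /(_ u I)]; rewrite !enorm2 => hv.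
have {}hu : t * J u + dot (f - u) (v - u) <= t * J v.
  rewrite (_ : _ + _ = t * (J u + dot (t^-1 *: (f - u)) (v - u))); last first.
    by rewrite mulrDr dotZl mulVKf ?gt_eqF.
  by rewrite ler_pM2l.
apply/eqP; rewrite -subr_eq0; apply/eqP; apply: dot_le0.
have -> : dot (v - u) (v - u) = dot (v - f) (v - f) - dot (u - f) (u - f)
    + 2 * dot (f - u) (v - u).
  by rewrite !dotE (dotC u v) (dotC u f) (dotC v f); ring.
lra.
Qed.

End variational.

(** * The integral of the velocity *)
Lemma integrable_setU d (T : measurableType d) (R : realType)
    (mu : {measure set T -> \bar R}) (A B : set T) (g : T -> \bar R) :
    measurable A -> measurable B -> [disjoint A & B] ->
    mu.-integrable A g -> mu.-integrable B g ->
  mu.-integrable (A `|` B) g.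
Proof.
move=> mA mB AB /integrableP[mgA gA] /integrableP[mgB gB].
have mg : measurable_fun (A `|` B) g by apply/(measurable_funU _ mA mB).
apply/integrableP; split => //.
rewrite ge0_integral_setU //; first exact: lte_add_pinfty.
exact: measurableT_comp.
Qed.

Section velocity_integral.
Context {R : realType}.
Let mu := @lebesgue_measure R.
Implicit Types (a t : R).

Lemma integral_extend_cst (g : R -> R) a t (k : R) : 0 <= a -> a < t ->
    (forall s, a < s -> s <= t -> g s = k) ->
    mu.-integrable `[0, a] (EFin \o g) ->
  mu.-integrable `[0, t] (EFin \o g) /\
  \int[mu]_(s in `[0, t]) g s = \int[mu]_(s in `[0, a]) g s + k * (t - a).
Proof.
move=> a0 at_ gk ia.
have mE : mu `]a, t]%classic = (t - a)%:E.
  by rewrite /mu lebesgue_measure_itv /= lte_fin at_ -EFinB.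
have gk' : {in `]a, t]%classic, g =1 cst k}.
  by move=> s; rewrite inE /= in_itv /= => /andP[as_ st]; exact: gk.
have it : mu.-integrable `[0, t] (EFin \o g).
  rewrite (@itv_bndbnd_setU _ _ _ (BRight a)) ?bnd_simp ?(ltW at_) //.
  apply: integrable_setU => //.
    apply/disj_setPS => s [/=]; rewrite !in_itv /= => /andP[_ sa] /andP[as_ _].
    by move: (le_lt_trans sa as_); rewrite ltxx.
  apply: (eq_integrable _ (EFin \o cst k)) => // [s /gk' /= ->//|].
  apply/integrableP; split; first exact/measurable_EFinP.
  by rewrite /= integral_cst // [X in (_ * X)%E]mE -EFinM ltry.
split => //; apply/eqP; rewrite addrC -subr_eq; apply/eqP.
rewrite Rintegral_itvB ?bnd_simp // ?(ltW at_) //.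
transitivity (\int[mu]_(s in `]a, t]) cst k s); first exact: eq_Rintegral.
by rewrite Rintegral_cst // [X in fine X]mE.
Qed.

End velocity_integral.

Section displacement.
Context {R : realType} {n : nat} (J : 'rV[R]_n -> R).
Variables (f : 'rV[R]_n) (x c : R -> 'rV[R]_n).
Hypotheses (GF : gradient_flow J f x c).
Implicit Types (a b s t : R) (p : 'rV[R]_n).

(** The velocity is only known almost everywhere, so the displacement is recovered
    coordinatewise from the monotonicity criterion, in both directions. *)
Lemma flow_affine_of_constant a b p : 0 <= a -> a <= b ->
  (forall t, a < t -> t <= b -> c t = p) -> x a - x b = (b - a) *: p.
Proof.
move=> a0 ab cp; apply/rowP => i; rewrite -!dot_delta; set w := delta_mx 0 i.
have mono k : flow_functional x w (dot p w) k b <= flow_functional x w (dot p w) k a.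
  apply: (flow_nonincreasing GF a0 ab).
    exact: abs_continuous_flow_functional GF _ _ _ _ _ a0 ab.
  move=> t /andP[at_ tb]; rewrite cp ?(ltW tb) // => dx _.
  eexists; first exact: is_derive_flow_functional dx.
  by rewrite subrr mulr0.
by have := mono 1; have := mono (-1); rewrite /flow_functional !dotE; lra.
Qed.

Lemma piece_of_time K (tau : nat -> \bar R) t0 t :
    tau 0%N = t0%:E -> tau K = +oo%E -> t0 < t ->
  exists i, [/\ (i < K)%N, (tau i < t%:E)%E & (t%:E <= tau i.+1)%E].
Proof.
move=> tau0 tauK t0t; have exk : exists k, (t%:E <= tau k)%E.
  by exists K; rewrite tauK leey.
case: (ex_minnP exk) => -[|i] ti imin; first by move: ti; rewrite tau0 lee_fin leNgt t0t.
have it : (tau i < t%:E)%E by rewrite ltNge; apply/negP => /imin; rewrite ltnn.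
exists i; split => //; rewrite -ltnS; apply: leq_ltn_trans (imin K _) _ => //.
by rewrite tauK leey.
Qed.

Lemma piece_left_end K (tau : nat -> \bar R) t i :
    tau 0%N = 0%E -> (forall i, (i < K)%N -> (tau i < tau i.+1)%E) ->
    (i < K)%N -> (tau i < t%:E)%E ->
  exists a, [/\ tau i = a%:E, 0 <= a & a < t].
Proof.
move=> tau0 tauS iK it.
have := piecewise_constant_from_ge tau0 tauS (ltnW iK).
by move: it; case: (tau i) => [a| |] // ? ?; exists a.
Qed.

Lemma flow_integral t : piecewise_constant c -> 0 < t ->
  vector_integral c t = f - x t.
Proof.
move=> [K [tau [tau0 tauK tauS tauc]]] t0.
have [_ x0 _] := GF; apply/rowP => j; rewrite !mxE.
pose mu := @lebesgue_measure R; pose cj s := c s 0 j.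
pose Q s := mu.-integrable `[0, s] (EFin \o cj) /\
  \int[mu]_(r in `[0, s]) cj r = f 0 j - x s 0 j.
have Q0 : Q 0.
  have E0 : `[0, 0]%classic = [set 0 : R] by rewrite set_itv1.
  split; last by rewrite E0 Rintegral_set1 x0 subrr.
  rewrite E0; apply: (eq_integrable _ (EFin \o cst (cj 0))) => //.
    by move=> s; rewrite inE /= => ->.
  apply/integrableP; split; first exact/measurable_EFinP.
  by rewrite integral_set1 ltry.
(* The integral identity propagates from the left end of a piece through it. *)
have step i s : (i < K)%N -> (tau i < s%:E)%E -> (s%:E <= tau i.+1)%E ->
    (forall a, tau i = a%:E -> Q a) -> Q s.
  move=> iK is_ si Qi; have [a [taua a0 as_]] := piece_left_end tau0 tauS iK is_.
  have [p cp] := tauc _ iK.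
  have {}cp r : a < r -> r <= s -> c r = p.
    move=> ar rs; apply: cp; first by rewrite taua lte_fin.
    by apply: le_trans si; rewrite lee_fin.
  have [ia Ia] := Qi a taua.
  have [|is0 Is] := integral_extend_cst a0 as_ _ ia (k := p 0 j).
    by move=> r ar rs; rewrite /cj cp.
  split=> //; rewrite [LHS]Is [X in X + _]Ia.
  have := congr1 (fun v : 'rV[R]_n => v 0 j)
    (flow_affine_of_constant a0 (ltW as_) cp).
  by rewrite !mxE => xas; rewrite [p 0 j * _]mulrC -xas; ring.
suff [//] : Q t.
have [i [iK it ti]] := piece_of_time tau0 tauK t0.
elim: i t {t0} iK it ti => [|i IHi] t iK it ti; apply: (step _ _ iK it ti) => a taua.
  by move: taua; rewrite tau0 => -[<-].
have := tauS i (ltnW iK).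
by rewrite taua => ia; apply: IHi => //; [exact: ltnW|rewrite taua].
Qed.

End displacement.

Theorem theorem5 (R : realType) (n : nat) (J : 'rV[R]_n -> R) (f : 'rV[R]_n)
  (J_ge0 : forall u, 0 <= J u)
  (J_convex : @convex_function R 'rV[R]_n setT J)
  (J_lsc : lower_semicontinuous (fun u => (J u)%:E))
  (J_hom : one_homogeneous J)
  (J_PS : PS J)
  (J_MINSUB : MINSUB J)
  (uGF p : R -> 'rV[R]_n) (GF : gradient_flow J f uGF p)
  (uVM : R -> 'rV[R]_n) (VM : variational_solution J f uVM) :
  (exists pGF, gradient_flow J f uGF pGF /\ piecewise_constant pGF) /\
  forall pGF, gradient_flow J f uGF pGF -> piecewise_constant pGF ->
    [/\ (forall s t : R, 0 < s -> s <= t -> subdiff J (uGF t) (pGF s)),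
        (forall t : R, 0 <= t -> uGF t = uVM t) &
        (forall t : R, 0 < t ->
           [/\ variational_subgradient f uVM t = t^-1 *: vector_integral pGF t,
               subdiff J (uVM t) (variational_subgradient f uVM t) &
               subdiff J (uGF t) (variational_subgradient f uVM t)])].
Proof.
have sJ := convex_homogeneous_sublinear J_convex J_hom.
have [V0 /finite_seqP[V ->] hV] := J_PS.
have [c [E [finE pcc mono dc]]] := flow_structure sJ hV J_MINSUB GF (lexx 0).
have avg := flow_average_subgradient sJ hV J_MINSUB GF.
have [ACx x0 _] := GF; have [VM0 VMt] := VM.
have uE t : 0 <= t -> uGF t = uVM t.
  rewrite le_eqVlt => /predU1P[<-|t0]; first by rewrite x0 VM0.
  by rewrite (variational_minimizer_unique t0 (avg t t0) (VMt t t0)).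
split.
  exists c; split => //; split => //.
  have nE : lebesgue_measure.-negligible E.
    apply/negligibleP; first exact: countable_measurable (finite_set_countable finE).
    exact/countable_lebesgue_measure0/finite_set_countable.
  by apply: negligibleS nE => t /=; apply: contra_notP => tE t0; exact: dc.
move=> q GFq pcq; split => // [s t s0 st|t t0].
  have [K [tau [tau0 tauK tauS tauc]]] := pcq.
  have [i [iK is_ si]] := piece_of_time tau0 tauK s0.
  have [a [taua a0 as_]] := piece_left_end tau0 tauS iK is_.
  have [r rc] := tauc _ iK.
  (* [q s] is also the velocity at an earlier time [b] of the same piece at which
     the inclusion holds, and from [b] on the subdifferential only grows. *)
  have [_ _ aeq] := GFq; have [b /andP[ab bs] hb] := ae_itv_exists as_ aeq.
  have [|_ qb] := hb; first exact: le_lt_trans ab.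
  have -> : q s = q b.
    rewrite !rc // ?taua ?lte_fin //.
    by apply: le_trans si; rewrite lee_fin ltW.
  by apply: mono qb; [exact: le_trans (ltW ab)|exact: le_trans (ltW bs) st].
have -> : variational_subgradient f uVM t = t^-1 *: (f - uGF t).
  by rewrite /variational_subgradient -uE // ltW.
rewrite -(uE t) ?ltW //; split; [|exact: avg|exact: avg].
by rewrite (flow_integral GFq pcq t0).
Qed.
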